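(* Let $p$ be a prime and let $\mathcal{C}$ be a $\mathbb{Z}_p\mathbb{Z}_p[u,v]$-additive $(1+u+v)$-constacyclic code of length $(\alpha,\beta)$. Let $\Phi_2:\mathbb{Z}_p^\alpha\times\mathbb{Z}_p[u,v]^\beta\to\mathbb{Z}_p^{\alpha+2\beta}$ be the map sending $(e_0,\dots,e_{\alpha-1},r_0,\dots,r_{\beta-1})$, with $r_i=a_i+ub_i+vc_i$, to $$(e_0,\dots,e_{\alpha-1},\,b_0-c_0,\dots,b_{\beta-1}-c_{\beta-1},\,a_0-b_0+c_0,\dots,a_{\beta-1}-b_{\beta-1}+c_{\beta-1}).$$ Then $\Phi_2(\mathcal{C})$ is a generalized quasi-cyclic code of block length $(\alpha,\beta,\beta)$ over $\mathbb{Z}_p$.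
   Context: $R=\mathbb{Z}_p[u,v]$ denotes the ring $\mathbb{Z}_p+u\mathbb{Z}_p+v\mathbb{Z}_p$ with $u^2=v^2=uv=vu=0$; $\rho:R\to\mathbb{Z}_p$, $\rho(a+ub+vc)=a$. A $\mathbb{Z}_p\mathbb{Z}_p[u,v]$-additive code of length $(\alpha,\beta)$ is an $R$-submodule of $\mathbb{Z}_p^\alpha\times R^\beta$, where $z*(c,d)=(\rho(z)c,zd)$; for a unit $\lambda\in R$ it is additive $\lambda$-constacyclic if it is closed under $(c_0,\dots,c_{\alpha-1},d_0,\dots,d_{\beta-1})\mapsto(c_{\alpha-1},c_0,\dots,c_{\alpha-2},\lambda d_{\beta-1},d_0,\dots,d_{\beta-2})$. A generalized quasi-cyclic code of block length $(m_1,\dots,m_\ell)$ over $\mathbb{Z}_p$ is a linear code in $\mathbb{Z}_p^{m_1}\times\dots\times\mathbb{Z}_p^{m_\ell}$ invariant under simultaneously cyclically shifting each of the $\ell$ blocks by one position. *)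

(* Defs.v *)
From HB Require Import structures.
From mathcomp Require Import all_boot all_order all_algebra.
From mathcomp Require Import ring.

Set Implicit Arguments.
Unset Strict Implicit.
Unset Printing Implicit Defensive.

Import GRing.Theory.
Local Open Scope ring_scope.

(* [Ruv a b c] is a + u b + v c. *)
Record ruv (F : Type) := Ruv { rho : F; ucoef : F; vcoef : F }.

Section RuvEncoding.
Variable F : Type.
Definition ruv_triple (r : ruv F) := (rho r, ucoef r, vcoef r).
Definition triple_ruv (t : F * F * F) := Ruv t.1.1 t.1.2 t.2.
Lemma ruv_tripleK : cancel ruv_triple triple_ruv.
Proof. by case. Qed.
End RuvEncoding.

HB.instance Definition _ (F : eqType) :=
  Equality.copy (ruv F) (can_type (@ruv_tripleK F)).
HB.instance Definition _ (F : choiceType) :=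
  Choice.copy (ruv F) (can_type (@ruv_tripleK F)).
HB.instance Definition _ (F : countType) :=
  Countable.copy (ruv F) (can_type (@ruv_tripleK F)).
HB.instance Definition _ (F : finType) :=
  Finite.copy (ruv F) (can_type (@ruv_tripleK F)).

Section RuvZmodule.
Variable F : zmodType.
Implicit Types r s t : ruv F.

Definition ruv_zero : ruv F := Ruv 0 0 0.
Definition ruv_opp r := Ruv (- rho r) (- ucoef r) (- vcoef r).
Definition ruv_add r s :=
  Ruv (rho r + rho s) (ucoef r + ucoef s) (vcoef r + vcoef s).

Fact ruv_addA : associative ruv_add.
Proof. by move=> r s t; rewrite /ruv_add /= !addrA. Qed.
Fact ruv_addC : commutative ruv_add.
Proof. by move=> r s; congr Ruv; rewrite addrC. Qed.
Fact ruv_add0 : left_id ruv_zero ruv_add.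
Proof. by case=> a b c; rewrite /ruv_add /= !add0r. Qed.
Fact ruv_addN : left_inverse ruv_zero ruv_opp ruv_add.
Proof. by move=> r; rewrite /ruv_add /= !addNr. Qed.

HB.instance Definition _ :=
  GRing.isZmodule.Build (ruv F) ruv_addA ruv_addC ruv_add0 ruv_addN.
End RuvZmodule.

Section RuvRing.
Variable F : comNzRingType.
Implicit Types r s t : ruv F.

Definition ruv_one : ruv F := Ruv 1 0 0.
Definition ruv_mul r s :=
  Ruv (rho r * rho s)
      (rho r * ucoef s + ucoef r * rho s)
      (rho r * vcoef s + vcoef r * rho s).

Fact ruv_mulA : associative ruv_mul.
Proof. by move=> r s t; congr Ruv => /=; ring. Qed.
Fact ruv_mulC : commutative ruv_mul.
Proof. by move=> r s; congr Ruv => /=; ring. Qed.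
Fact ruv_mul1 : left_id ruv_one ruv_mul.
Proof. by case=> a b c; congr Ruv => /=; ring. Qed.
Fact ruv_mulDl : left_distributive ruv_mul (@GRing.add (ruv F)).
Proof. by move=> r s t; congr Ruv => /=; ring. Qed.
Fact ruv_oner_neq0 : ruv_one != 0.
Proof. by apply/eqP => -[] /eqP; rewrite oner_eq0. Qed.

HB.instance Definition _ := GRing.Zmodule_isComNzRing.Build (ruv F)
  ruv_mulA ruv_mulC ruv_mul1 ruv_mulDl ruv_oner_neq0.

Definition ruv_u : ruv F := Ruv 0 1 0.
Definition ruv_v : ruv F := Ruv 0 0 1.

Lemma ruv_uu : ruv_u * ruv_u = 0.
Proof. by congr Ruv => /=; ring. Qed.
Lemma ruv_vv : ruv_v * ruv_v = 0.
Proof. by congr Ruv => /=; ring. Qed.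
Lemma ruv_uv : ruv_u * ruv_v = 0.
Proof. by congr Ruv => /=; ring. Qed.
Lemma rho_is_zmod_morphism : zmod_morphism (@rho F).
Proof. by []. Qed.
Lemma rho_is_monoid_morphism : monoid_morphism (@rho F).
Proof. by []. Qed.

HB.instance Definition _ :=
  GRing.isZmodMorphism.Build (ruv F) F (@rho F) rho_is_zmod_morphism.
HB.instance Definition _ :=
  GRing.isMonoidMorphism.Build (ruv F) F (@rho F) rho_is_monoid_morphism.
End RuvRing.

Arguments ruv_u {F}.
Arguments ruv_v {F}.

Section RuvUnit.
Variable F : fieldType.
Implicit Types r s : ruv F.

Definition ruv_unit : {pred ruv F} := fun r => rho r != 0.
Definition ruv_inv r :=
  if rho r == 0 then r
  else Ruv (rho r)^-1 (- ucoef r / rho r ^+ 2) (- vcoef r / rho r ^+ 2).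

Fact ruv_mulV : {in ruv_unit, left_inverse 1 ruv_inv *%R}.
Proof.
case=> a b c; rewrite unfold_in /ruv_inv /= => a0; rewrite (negPf a0).
by congr Ruv => /=; field.
Qed.
Fact ruv_unitP r s : s * r = 1 -> ruv_unit r.
Proof.
move=> /(congr1 (@rho F)) /= sr1; apply/eqP => r0.
by move/eqP: sr1; rewrite r0 mulr0 eq_sym oner_eq0.
Qed.
Fact ruv_inv_out : {in [predC ruv_unit], ruv_inv =1 id}.
Proof. by move=> r; rewrite !unfold_in /= /ruv_inv negbK => ->. Qed.

HB.instance Definition _ := GRing.ComNzRing_hasMulInverse.Build (ruv F)
  ruv_mulV ruv_unitP ruv_inv_out.

Lemma unit_1uv : 1 + ruv_u + ruv_v \is a @GRing.unit (ruv F).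
Proof. by rewrite unfold_in /= /ruv_unit /= !addr0 oner_neq0. Qed.
End RuvUnit.

(* A fresh name for the product, so that it carries the ruv-module structure
   in which the left factor is acted on through rho. *)
Definition mixed (F : Type) (alpha beta : nat) : Type :=
  ('rV[F]_alpha * 'rV[ruv F]_beta)%type.

HB.instance Definition _ (F : finType) alpha beta :=
  Finite.copy (mixed F alpha beta) ('rV[F]_alpha * 'rV[ruv F]_beta)%type.
HB.instance Definition _ (F : zmodType) alpha beta :=
  GRing.Zmodule.copy (mixed F alpha beta) ('rV[F]_alpha * 'rV[ruv F]_beta)%type.

Section MixedModule.
Variables (F : comNzRingType) (alpha beta : nat).
Implicit Types (z w : ruv F) (x y : mixed F alpha beta).

Definition mixed_scale z x : mixed F alpha beta := (rho z *: x.1, z *: x.2).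

Fact mixed_scaleA z w x :
  mixed_scale z (mixed_scale w x) = mixed_scale (z * w) x.
Proof. by rewrite /mixed_scale /= !scalerA. Qed.
Fact mixed_scale1 : left_id 1 mixed_scale.
Proof. by case=> c d; rewrite /mixed_scale /= !scale1r. Qed.
Fact mixed_scaleDr : right_distributive mixed_scale +%R.
Proof. by move=> z x y; rewrite /mixed_scale /= !scalerDr. Qed.
Fact mixed_scaleDl x : {morph mixed_scale^~ x : z w / z + w}.
Proof. by move=> z w; rewrite /mixed_scale /= !scalerDl. Qed.

HB.instance Definition _ := GRing.Zmodule_isLmodule.Build
  (ruv F) (mixed F alpha beta)
  mixed_scaleA mixed_scale1 mixed_scaleDr mixed_scaleDl.
End MixedModule.

(* (x_0, ..., x_(n-1)) |-> (x_(n-1), x_0, ..., x_(n-2)) *)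
Definition cshift (T : Type) (n : nat) (x : 'rV[T]_n) : 'rV[T]_n :=
  \row_i x 0 (ord_pred i).

(* (x_0, ..., x_(n-1)) |-> (l x_(n-1), x_0, ..., x_(n-2)) *)
Definition constashift (A : pzRingType) (n : nat) (l : A) (x : 'rV[A]_n) :
    'rV[A]_n :=
  \row_i (if i == 0%N :> nat then l * x 0 (ord_pred i) else x 0 (ord_pred i)).

Definition mixed_shift (F : comNzRingType) (alpha beta : nat) (l : ruv F)
    (x : mixed F alpha beta) : mixed F alpha beta :=
  (cshift x.1, constashift l x.2).

Section Codes.
Variable p : nat.

Definition additive_code alpha beta (C : {set mixed 'F_p alpha beta}) : Prop :=
  submod_closed C.

Definition additive_constacyclic alpha beta (l : ruv 'F_p)
    (C : {set mixed 'F_p alpha beta}) : Prop :=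
  [/\ l \is a GRing.unit, additive_code C
    & forall x, x \in C -> mixed_shift l x \in C].

(* Z_p^m1 x ... x Z_p^ml is identified with Z_p^(m1 + ... + ml). *)
Fixpoint block_shift (ms : seq nat) : 'rV['F_p]_(sumn ms) -> 'rV['F_p]_(sumn ms) :=
  if ms is m :: ms' return 'rV['F_p]_(sumn ms) -> 'rV['F_p]_(sumn ms) then
    fun x : 'rV['F_p]_(m + sumn ms') =>
      row_mx (cshift (lsubmx x)) (block_shift (rsubmx x))
  else id.

Definition generalized_quasi_cyclic (ms : seq nat)
    (D : {set 'rV['F_p]_(sumn ms)}) : Prop :=
  submod_closed D /\ forall x, x \in D -> block_shift x \in D.

(* alpha + 2 * beta, alpha + (beta + (beta + 0)) and sumn [:: alpha; beta; beta]
   are convertible; the last block of the row is the empty vector. *)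
Definition Phi2 alpha beta (x : mixed 'F_p alpha beta) :
    'rV['F_p]_(alpha + 2 * beta) :=
  let a := map_mx (@rho 'F_p) x.2 in
  let b := map_mx (@ucoef 'F_p) x.2 in
  let c := map_mx (@vcoef 'F_p) x.2 in
  row_mx x.1 (row_mx (b - c) (row_mx (a - b + c) (0 : 'rV_0))).

End Codes.

(* Main.v *)
(* Multiplication by 1 + u + v sends a + ub + vc to a + u(a + b) + v(a + c), so
   it preserves both b - c and a - b + c; hence Phi2 turns the
   (1 + u + v)-constacyclic shift into the plain cyclic shift of each block. *)
Require Import Defs.
From mathcomp Require Import all_boot all_order all_algebra.
From mathcomp Require Import ring.

Import GRing.Theory.
Local Open Scope ring_scope.

(** The field sits in the ring as the scalars [Ruv k 0 0], so an additive code is also closed under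
    ['F_p]-combinations. *)
Lemma Phi2_linear (p alpha beta : nat) (k : 'F_p) (x y : mixed 'F_p alpha beta) :
  Phi2 (Ruv k 0 0 *: x + y) = k *: Phi2 x + Phi2 y.
Proof.
rewrite /Phi2 /= !scale_row_mx !add_row_mx scaler0 addr0.
by congr (row_mx _ (row_mx _ (row_mx _ _))); apply/rowP=> i; rewrite !mxE /=; ring.
Qed.

Lemma block_shift_row_mx (p m : nat) (ms : seq nat) (x : 'rV['F_p]_m)
    (y : 'rV['F_p]_(sumn ms)) :
  block_shift (ms := m :: ms) (row_mx x y) = row_mx (cshift x) (block_shift y).
Proof. by rewrite /= row_mxKl row_mxKr. Qed.

Lemma Phi2_mixed_shift (p alpha beta : nat) (x : mixed 'F_p alpha beta) :
  Phi2 (mixed_shift (1 + ruv_u + ruv_v) x) =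
  block_shift (ms := [:: alpha; beta; beta]) (Phi2 x).
Proof.
rewrite [RHS](block_shift_row_mx p alpha [:: beta; beta]).
rewrite (block_shift_row_mx p beta [:: beta]) (block_shift_row_mx p beta [::]).
(* The case split isolates the wrapped-around entry [i = 0], the only one multiplied by
   [1 + u + v]. *)
by congr (row_mx _ (row_mx _ (row_mx _ _))); apply/rowP=> i; rewrite !mxE;
  case: ifP => _ //=; ring.
Qed.

Theorem theorem20 (p : nat) (p_prime : prime p) (alpha beta : nat)
    (C : {set mixed 'F_p alpha beta}) :
  additive_constacyclic (1 + ruv_u + ruv_v) C ->
  generalized_quasi_cyclic (ms := [:: alpha; beta; beta])
    [set Phi2 x | x in C].
Proof.
case=> _ [C0 Clin] Cshift; split; first split.
- apply/imsetP; exists 0 => //.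
  (* With [k = -1], linearity reads [Phi2 0 = - Phi2 0 + Phi2 0], which is [0]. *)
  have := Phi2_linear p alpha beta (-1) 0 0.
  by rewrite scaler0 addr0 scaleN1r addNr => ->.
- move=> k _ _ /imsetP[x Cx ->] /imsetP[y Cy ->].
  by rewrite -[X in X \in _]Phi2_linear; apply/imset_f/Clin.
- move=> _ /imsetP[x Cx ->].
  by rewrite -Phi2_mixed_shift; apply/imset_f/Cshift.
Qed.
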